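(* Let $(X,* )$ be a nonempty proto-unital shelf. Then the two-term (rack) homology of $X$ is $\mathbb{Z}$ in all dimensions: $H_n^R(X)\cong\mathbb{Z}$ for all $n\ge0$.
   Context: A shelf is a set $X$ with a binary operation $*$ satisfying $(a*b)*c=(a*c)*(b*c)$ for all $a,b,c\in X$. A proto-unital shelf is a shelf satisfying, for all $a,b\in X$: $a*b=b*(a*b)$ and $a*b=(a*b)*b$. Two-term (rack) homology of a shelf $(X,* )$: for $n\ge 0$ let $C_n=\mathbb{Z}X^{n+1}$ be the free abelian group on $(n+1)$-tuples $(x_0,\dots,x_n)$ of elements of $X$, with $C_{-1}=0$. For $n\ge1$ and $0\le i\le n$ put $d^{( *_0)}_{i,n}(x_0,\dots,x_n)=(x_0,\dots,x_{i-1},x_{i+1},\dots,x_n)$ and $d^{( * )}_{i,n}(x_0,\dots,x_n)=(x_0*x_i,\dots,x_{i-1}*x_i,x_{i+1},\dots,x_n)$ (so for $i=0$ both equal $(x_1,\dots,x_n)$), extended linearly. Let $d^R_{i,n}=d^{( *_0)}_{i,n}-d^{( * )}_{i,n}$ and $\partial^R_n=\sum_{i=0}^n(-1)^i d^R_{i,n}:C_n\to C_{n-1}$ (and $\partial^R_0=0$). Then $(C_n,\partial^R_n)$ is a chain complex and $H_n^R(X)=\ker(\partial^R_n)/\mathrm{im}(\partial^R_{n+1})$. *)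

(* Defs.v *)
From HB Require Import structures.
(* [freeg] comes first: its [lift] would hide [fintype.lift]. *)
From mathcomp.multinomials Require Import freeg.
From mathcomp Require Import all_boot all_order all_algebra.
From mathcomp Require Import boolp.

Set Implicit Arguments.
Unset Strict Implicit.
Unset Printing Implicit Defensive.

Import GRing.Theory.
Local Open Scope ring_scope.

Definition is_shelf (X : Type) (op : X -> X -> X) : Prop :=
  forall a b c, op (op a b) c = op (op a c) (op b c).

Definition is_proto_unital_shelf (X : Type) (op : X -> X -> X) : Prop :=
  [/\ is_shelf op,
      forall a b, op a b = op b (op a b)
    & forall a b, op a b = op (op a b) b].

(* [freeg] needs a choiceType of generators; [{classic X}] is [X] itself, with
   choice structure supplied by the axiom of choice. *)
Definition chain (X : Type) (n : nat) : zmodType :=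
  {freeg (n.+1.-tuple {classic X}) / int}.

Section RackComplex.
Context (X : Type) (op : X -> X -> X).

Definition linear_ext (m n : nat)
    (f : m.+1.-tuple {classic X} -> n.+1.-tuple {classic X}) :
    chain X m -> chain X n :=
  fglift (fun x => << f x >> : {freeg (n.+1.-tuple {classic X}) / int}).

HB.instance Definition _ m n f :=
  GRing.isZmodMorphism.Build (chain X m) (chain X n) (@linear_ext m n f)
    (lift_is_additive _).

(* The face maps d_{i,n} of both operations, for n = m.+1: the entry at
   position j of the result comes from position [lift i j] of x, which is j
   for j < i and j.+1 otherwise. *)
Definition trivial_face (m : nat) (i : 'I_m.+2) (x : m.+2.-tuple {classic X}) :
    m.+1.-tuple {classic X} :=
  [tuple tnth x (lift i j) | j < m.+1].

Definition op_face (m : nat) (i : 'I_m.+2) (x : m.+2.-tuple {classic X}) :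
    m.+1.-tuple {classic X} :=
  [tuple if (j < i)%N then op (tnth x (lift i j)) (tnth x i)
         else tnth x (lift i j) | j < m.+1].

Definition rack_face (m : nat) (i : 'I_m.+2) (c : chain X m.+1) : chain X m :=
  linear_ext (trivial_face i) c - linear_ext (op_face i) c.

(* In degree 0 the target should be C_{-1} = 0; the boundary being zero there,
   the value [chain X 0.-1] of the codomain is irrelevant. *)
Definition rack_boundary (n : nat) : chain X n -> chain X n.-1 :=
  match n return chain X n -> chain X n.-1 with
  | 0 => fun=> 0
  | m.+1 => fun c => \sum_(i < m.+2) rack_face i c *~ (-1) ^+ i
  end.

Lemma rack_boundary_is_zmod_morphism n : zmod_morphism (@rack_boundary n).
Proof.
case: n => [|m] c d /=; first by rewrite subr0.
rewrite -sumrB; apply: eq_bigr => i _; rewrite -mulrzBl; congr (_ *~ _).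
rewrite /rack_face (raddfB (linear_ext (trivial_face i))).
by rewrite (raddfB (linear_ext (op_face i))) /= opprD addrACA -opprD.
Qed.

HB.instance Definition _ n :=
  GRing.isZmodMorphism.Build (chain X n) (chain X n.-1) (@rack_boundary n)
    (@rack_boundary_is_zmod_morphism n).

Definition rack_ker (n : nat) : {pred chain X n} :=
  [pred c | rack_boundary c == 0].

Lemma rack_ker_zmod_closed n : zmod_closed (@rack_ker n).
Proof.
split=> [|c d]; rewrite !inE ?raddf0 //.
by move=> /eqP c0 /eqP d0; rewrite raddfB /= c0 d0 subr0.
Qed.

HB.instance Definition _ n :=
  GRing.isZmodClosed.Build (chain X n) (@rack_ker n) (@rack_ker_zmod_closed n).

Record rack_cycle (n : nat) := RackCycle {
  cycle_val : chain X n;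
  _ : cycle_val \in @rack_ker n
}.

HB.instance Definition _ n := [isSub for @cycle_val n].
HB.instance Definition _ n := [Choice of rack_cycle n by <:].
HB.instance Definition _ n :=
  [SubChoice_isSubZmodule of rack_cycle n by <:].

(* The image of the boundary from degree n.+1, seen inside the kernel in
   degree n; nothing is lost when [op] is a shelf, the boundary then squaring
   to zero. *)
Definition rack_im (n : nat) : {pred rack_cycle n} :=
  [pred z | `[< exists c : chain X n.+1, rack_boundary c = cycle_val z >]].

Lemma rack_im_zmod_closed n : zmod_closed (@rack_im n).
Proof.
split=> [|y z]; rewrite !inE.
  apply/asboolP; exists 0; rewrite !raddf0.
  exact/esym/(raddf0 (val : rack_cycle n -> _)).
move=> /asboolP[c cy] /asboolP[d dz]; apply/asboolP; exists (c - d).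
rewrite [RHS](raddfB (val : rack_cycle n -> _)) /= -cy -dz.
exact: (raddfB (@rack_boundary n.+1)).
Qed.

HB.instance Definition _ n :=
  GRing.isZmodClosed.Build (rack_cycle n) (@rack_im n) (@rack_im_zmod_closed n).

Definition rack_homology (n : nat) : zmodType := @Quotient.quot (rack_cycle n) (@rack_im n).

End RackComplex.

(* Main.v *)
Require Import Defs.
From HB Require Import structures.
(* [freeg] comes first: its [lift] would hide [fintype.lift]. *)
From mathcomp.multinomials Require Import freeg.
From mathcomp Require Import all_boot all_order all_algebra.
From mathcomp Require Import boolp.

(** The isomorphism is induced by the augmentation [deg], which sends a chain
    to the sum of its coefficients.  It kills boundaries because each face map
    is a difference of two maps that send generators to generators.

    Appending an element k at the end of a tuple gives a chain homotopy, up to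
    sign, between the identity and the diagonal right translation
    (x_0, ..., x_n) |-> (x_0 * k, ..., x_n * k)
    ([rack_boundary_append]).  So any cycle c is homologous to its translate
    by any k.  A proto-unital shelf is associative ([proto_unital_assoc]), and
    this gives, for any finite set S of elements, some k with s * k = k for all
    s in S ([common_absorber]).  Taking for S the finitely many entries of c,
    the translate of c by k is (k, ..., k) multiplied by the augmentation of c.
    Hence a cycle of augmentation 0 is a boundary ([cycle_degree0_boundary]).
    Surjectivity comes from the cycle (e, ..., e), for an idempotent e. *)

Set Implicit Arguments.
Unset Strict Implicit.
Unset Printing Implicit Defensive.

Import GRing.Theory.
Local Open Scope ring_scope.
Local Open Scope quotient_scope.

(** * Proto-unital shelves *)

Section ProtoUnitalShelf.
Context (X : Type) (op : X -> X -> X) (X_pus : is_proto_unital_shelf op).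

Lemma proto_unital_assoc a b c : op (op a b) c = op a (op b c).
Proof.
have [shelf opl opr] := X_pus.
(* With d = b * c: (a * c) * d = (a * d) * (c * d) = (a * d) * d = a * d. *)
have absorb : op (op a c) (op b c) = op a (op b c).
  by rewrite shelf -opl -opr.
by rewrite shelf absorb.
Qed.

Lemma op_diag_idem a : op (op a a) (op a a) = op a a.
Proof. by have [shelf _ opr] := X_pus; rewrite -shelf -opr. Qed.

Lemma common_absorber (X_nonempty : inhabited X) (s : seq {classic X}) :
  exists k, forall a, a \in s -> op a k = k.
Proof.
have [_ opl _] := X_pus.
elim: s => [|t s [k sk]]; first by have [x] := X_nonempty; exists x.
(* k * t inherits from k the absorption of s, and t absorbs it on the left. *)
exists (op k t) => a; rewrite inE => /orP[/eqP->|/sk ak].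
  by rewrite -opl.
by rewrite -proto_unital_assoc ak.
Qed.

End ProtoUnitalShelf.

(** * Chains and their augmentation *)

Section Chains.
Context (X : Type).

(** The generator of the chains given by a tuple. *)
Definition basis n (x : n.+1.-tuple {classic X}) : chain X n := << x >>.

Lemma raddf_chain n (V : zmodType) (f : {additive chain X n -> V}) c :
  f c = \sum_(x <- dom c) f (basis x) *~ coeff x c.
Proof.
rewrite -[in LHS](freeg_sumE c) raddf_sum; apply: eq_bigr => x _.
by rewrite -[X in << X *g _ >>]intz -freegU_mulz raddfMz.
Qed.

Lemma linear_ext_basis m n (f : m.+1.-tuple {classic X} -> _) x :
  @linear_ext X m n f (basis x) = basis (f x).
Proof. by rewrite /linear_ext liftU scale1r. Qed.

Lemma linear_ext_comp m n p (f : n.+1.-tuple {classic X} -> p.+1.-tuple _)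
    (g : m.+1.-tuple _ -> _) (c : chain X m) :
  linear_ext f (linear_ext g c) = linear_ext (f \o g) c.
Proof.
rewrite [LHS](raddf_chain (linear_ext f \o linear_ext g)).
rewrite [RHS]raddf_chain; apply: eq_bigr => x _.
by rewrite /= !linear_ext_basis.
Qed.

Lemma linear_ext_id n (f : n.+1.-tuple {classic X} -> _) (c : chain X n) :
  f =1 id -> linear_ext f c = c.
Proof.
move=> f_id; rewrite raddf_chain [RHS](raddf_chain idfun).
by apply: eq_bigr => x _; rewrite /= linear_ext_basis f_id.
Qed.

Lemma eq_linear_ext m n (f g : m.+1.-tuple {classic X} -> _) (c : chain X m) :
  f =1 g -> @linear_ext X m n f c = linear_ext g c.
Proof. by move=> /funext->. Qed.

Lemma deg_basis n (x : n.+1.-tuple {classic X}) : deg (basis x) = 1.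
Proof. exact: degU. Qed.

Lemma deg_sum_coeff n (c : chain X n) : deg c = \sum_(x <- dom c) coeff x c.
Proof.
rewrite [LHS](raddf_chain (@deg _ : {additive chain X n -> int})).
by apply: eq_bigr => x _; rewrite /= deg_basis intz.
Qed.

Lemma deg_linear_ext m n (f : m.+1.-tuple {classic X} -> _) (c : chain X m) :
  deg (@linear_ext X m n f c) = deg c.
Proof.
rewrite [LHS](raddf_chain (@deg _ \o linear_ext f)) deg_sum_coeff.
by apply: eq_bigr => x _; rewrite /= linear_ext_basis deg_basis intz.
Qed.

Lemma linear_ext_constant m n (f : m.+1.-tuple {classic X} -> _) y
    (c : chain X m) :
  {in dom c, forall x, f x = y} ->
  @linear_ext X m n f c = basis y *~ deg c.
Proof.
move=> fy; rewrite raddf_chain deg_sum_coeff mulrz_sumr.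
rewrite big_seq [RHS]big_seq; apply: eq_bigr => x xc.
by rewrite /= linear_ext_basis fy.
Qed.

End Chains.

(** * The appending homotopy *)

Section Append.
Context (X : Type) (op : X -> X -> X).

(** The tuple (x_0, ..., x_n, k). *)
Definition append (k : X) n (x : n.+1.-tuple {classic X}) :
    n.+2.-tuple {classic X} :=
  [tuple if unlift ord_max j is Some i then tnth x i else k | j < n.+2].

(** Diagonal right translation. *)
Definition translate (k : X) n (x : n.+1.-tuple {classic X}) :
    n.+1.-tuple {classic X} :=
  [tuple op (tnth x j) k | j < n.+1].

Lemma tnth_append_lift k n (x : n.+1.-tuple {classic X}) i :
  tnth (append k x) (lift ord_max i) = tnth x i.
Proof. by rewrite tnth_mktuple liftK. Qed.

Lemma tnth_append_max k n (x : n.+1.-tuple {classic X}) :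
  tnth (append k x) ord_max = k.
Proof. by rewrite tnth_mktuple unlift_none. Qed.

Lemma lift_lift_max n (i : 'I_n.+2) (j : 'I_n.+1) :
  lift (lift ord_max i) (lift ord_max j) = lift ord_max (lift i j).
Proof.
apply: val_inj; rewrite [RHS]lift_max.
by rewrite -[LHS]/(bump (lift ord_max i) (lift ord_max j)) !lift_max.
Qed.

Lemma lift_ord_max n (i : 'I_n.+1) : lift (lift ord_max i) ord_max = ord_max.
Proof.
apply: val_inj; rewrite -[LHS]/(bump (lift ord_max i) n) lift_max.
by rewrite /bump -ltnS ltn_ord.
Qed.

Lemma trivial_face_append k n i (x : n.+2.-tuple {classic X}) :
  trivial_face (lift ord_max i) (append k x) = append k (trivial_face i x).
Proof.
apply: eq_from_tnth => j; rewrite tnth_mktuple.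
case: (unliftP ord_max j) => [j'|] ->.
  by rewrite tnth_append_lift lift_lift_max tnth_append_lift tnth_mktuple.
by rewrite lift_ord_max !tnth_append_max.
Qed.

Lemma op_face_append k n i (x : n.+2.-tuple {classic X}) :
  op_face op (lift ord_max i) (append k x) = append k (op_face op i x).
Proof.
apply: eq_from_tnth => j; rewrite tnth_mktuple tnth_append_lift.
case: (unliftP ord_max j) => [j'|] ->.
  by rewrite lift_lift_max !tnth_append_lift tnth_mktuple !lift_max.
rewrite lift_ord_max !tnth_append_max lift_max ifN //.
by rewrite -leqNgt -ltnS ltn_ord.
Qed.

Lemma trivial_face_max_append k n (x : n.+1.-tuple {classic X}) :
  trivial_face ord_max (append k x) = x.
Proof.
by apply: eq_from_tnth => j; rewrite tnth_mktuple tnth_append_lift.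
Qed.

Lemma op_face_max_append k n (x : n.+1.-tuple {classic X}) :
  op_face op ord_max (append k x) = translate k x.
Proof.
apply: eq_from_tnth => j; rewrite tnth_mktuple [RHS]tnth_mktuple tnth_append_lift.
by rewrite tnth_append_max ltn_ord.
Qed.

Lemma rack_face0 n (c : chain X n.+1) : rack_face op ord0 c = 0.
Proof.
(* No position is below 0, so both face maps at 0 are convertible. *)
exact: subrr.
Qed.

Lemma rack_face_append k n i (c : chain X n.+1) :
  rack_face op (lift ord_max i) (linear_ext (@append k n.+1) c) =
  linear_ext (@append k n) (rack_face op i c).
Proof.
rewrite /rack_face [RHS]raddfB /= !linear_ext_comp.
by congr (_ - _); apply: eq_linear_ext => x /=;
  rewrite (trivial_face_append, op_face_append).
Qed.

Lemma rack_face_max_append k n (c : chain X n) :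
  rack_face op ord_max (linear_ext (@append k n) c) =
  c - linear_ext (@translate k n) c.
Proof.
rewrite /rack_face !linear_ext_comp; congr (_ - _).
  by apply: linear_ext_id => x; exact: trivial_face_max_append.
by apply: eq_linear_ext => x; exact: op_face_max_append.
Qed.

(** The homotopy formula between the identity and a diagonal translation,
    stated on cycles only so that degree 0 needs no separate treatment. *)
Lemma rack_boundary_append k n (c : chain X n) :
  rack_boundary op c = 0 ->
  rack_boundary op (linear_ext (@append k n) c) =
  (c - linear_ext (@translate k n) c) *~ (-1) ^+ n.+1.
Proof.
move=> c0; rewrite /= big_ord_recr /= rack_face_max_append.
rewrite -[RHS]add0r; congr (_ + _).
under eq_bigr => i _.
  have -> : widen_ord (leqnSn n.+1) i = lift ord_max i.
    by apply: val_inj; rewrite [RHS]lift_max.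
  over.
case: n c c0 => [|n] c c0.
  rewrite big_ord1.
  have -> : lift ord_max (ord0 : 'I_1) = ord0 by apply: val_inj; rewrite [LHS]lift_max.
  by rewrite rack_face0 mul0rz.
under eq_bigr => i _ do rewrite rack_face_append -raddfMz.
by rewrite -raddf_sum (_ : \sum_(i < _) _ = 0) ?raddf0 //; exact: c0.
Qed.

Lemma deg_rack_boundary n (c : chain X n.+1) : deg (rack_boundary op c) = 0.
Proof.
rewrite /= raddf_sum big1 // => i _.
by rewrite raddfMz /= /rack_face raddfB /= !deg_linear_ext subrr mul0rz.
Qed.

End Append.

(** * The augmentation on homology *)

Section Homology.
Context (X : Type) (op : X -> X -> X).
Context (X_nonempty : inhabited X) (X_pus : is_proto_unital_shelf op).

(** The tuple (k, ..., k). *)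
Definition diagonal n (k : X) : n.+1.-tuple {classic X} :=
  [tuple (k : {classic X}) | _ < n.+1].

Lemma cycle_degree0_boundary n (c : chain X n) :
  rack_boundary op c = 0 -> deg c = 0 ->
  exists b : chain X n.+1, rack_boundary op b = c.
Proof.
move=> c0 deg0.
pose entries := flatten [seq val x | x <- dom c].
have [k absorb] := common_absorber X_pus X_nonempty entries.
have translate0 : linear_ext (@translate X op k n) c = 0.
  rewrite (@linear_ext_constant _ _ _ _ (diagonal n k)) ?deg0 ?mulr0z //.
  move=> x xc; apply: eq_from_tnth => j; rewrite !tnth_mktuple; apply: absorb.
  by apply/flattenP; exists (val x); [exact: map_f | exact: mem_tnth].
exists (linear_ext (@append X k n) c *~ (-1) ^+ n.+1).
rewrite raddfMz [X in X *~ _](rack_boundary_append k c0) translate0 subr0.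
by rewrite -mulrzA -expr2 sqrr_sign.
Qed.

Lemma rack_boundary_diagonal n e :
  op e e = e -> rack_boundary op (basis (diagonal n e)) = 0.
Proof.
move=> ee; case: n => // n.
rewrite /= big1 // => i _; rewrite /rack_face !linear_ext_basis.
rewrite (_ : op_face _ _ _ = trivial_face i (diagonal n.+1 e)).
  by rewrite subrr mul0rz.
by apply: eq_from_tnth => j; rewrite !tnth_mktuple ee if_same.
Qed.

Lemma exists_cycle_degree1 n : exists z : rack_cycle op n, deg (val z) = 1.
Proof.
have [x] := X_nonempty; pose e := op x x.
have cyc : basis (diagonal n e) \in @rack_ker X op n.
  by rewrite inE rack_boundary_diagonal // (op_diag_idem X_pus).
by exists (RackCycle cyc); exact: deg_basis.
Qed.

(** The augmentation of a homology class, read off a chosen representative. *)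
Definition homology_degree n (h : rack_homology op n) : int :=
  deg (val (repr h)).

Lemma homology_degree_pi n (z : rack_cycle op n) :
  homology_degree (\pi_(rack_homology op n) z) = deg (val z).
Proof.
have : \pi_(rack_homology op n) (repr (\pi_(rack_homology op n) z)) =
       \pi_(rack_homology op n) z by exact: reprK.
move/eqP; rewrite -Quotient.idealrBE inE => /asboolP[b].
rewrite [RHS](raddfB (val : rack_cycle op n -> _)) => db.
by apply/eqP; rewrite -subr_eq0 -raddfB /= -db deg_rack_boundary.
Qed.

Lemma homology_degree_is_zmod_morphism n :
  zmod_morphism (@homology_degree n).
Proof.
move=> g h; rewrite -[g]reprK -[h]reprK -raddfB !homology_degree_pi.
by rewrite (raddfB (val : rack_cycle op n -> _)) raddfB.
Qed.

HB.instance Definition _ n :=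
  GRing.isZmodMorphism.Build (rack_homology op n) int (@homology_degree n)
    (@homology_degree_is_zmod_morphism n).

Lemma homology_degree_inj n : injective (@homology_degree n).
Proof.
apply: raddf_inj => h; rewrite -[h]reprK /= homology_degree_pi => deg0.
have /eqP z0 := valP (repr h).
have [b db] := cycle_degree0_boundary z0 deg0.
transitivity (\pi_(rack_homology op n) 0); last exact: raddf0.
by apply/eqP; rewrite -Quotient.idealrBE subr0 inE; apply/asboolP; exists b.
Qed.

Lemma homology_degree_bij n : bijective (@homology_degree n).
Proof.
have [z degz] := exists_cycle_degree1 n.
have gK : cancel (fun m : int => \pi_(rack_homology op n) z *~ m)
                 (@homology_degree n).
  by move=> m; rewrite raddfMz /= homology_degree_pi degz intz.
by exists (fun m : int => \pi_(rack_homology op n) z *~ m) => // h;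
  apply: homology_degree_inj; rewrite gK.
Qed.

End Homology.

Theorem theorem3p8 (X : Type) (op : X -> X -> X)
    (X_nonempty : inhabited X) (X_pus : is_proto_unital_shelf op) (n : nat) :
  exists f : {additive rack_homology op n -> int}, bijective f.
Proof.
by exists (@homology_degree X op n); exact: homology_degree_bij.
Qed.
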